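(* Let $p>0$ be a prime and let $(R,\mathfrak{m},K)$ be a standard graded $K$-algebra over a field $K$ of characteristic $p$, which is $F$-finite and $F$-pure, and let $J\subseteq R$ be a homogeneous compatible ideal. Then ${\operatorname{fpt}}(R)\leq {\operatorname{fpt}}(R/J)$. In particular, ${\operatorname{fpt}}(R)\leq {\operatorname{fpt}}(R/\tau)$ and ${\operatorname{fpt}}(R)\leq {\operatorname{fpt}}(R/\mathcal{P})\leq \operatorname{sdim}(R)$, where $\tau$ is the test ideal of $R$ and $\mathcal{P}$ is the splitting prime of $R$.
   Context: A standard graded $K$-algebra: $R=\bigoplus_{i\geq0}R_i$ Noetherian, $R_0=K$ a field, $R=K[R_1]$, $\dim_KR_1<\infty$, $\mathfrak{m}=\bigoplus_{i\geq1}R_i$. $F$-finite: $[K:K^p]<\infty$; $F$-pure: Frobenius is pure (equivalently $R\to R^{1/p}$ splits). An ideal $J$ is compatible if $\varphi(J^{1/p^e})\subseteq J$ for every $e\in\mathbb{N}$ and every $R$-linear $\varphi:R^{1/p^e}\to R$. For a graded ring $A$ of this type with homogeneous maximal ideal $\mathfrak{m}_A$ and $\lambda\geq0$, $(A,\mathfrak{m}_A^\lambda)$ is $F$-pure if for every $e\gg0$ there is $f\in\mathfrak{m}_A^{\lfloor(p^e-1)\lambda\rfloor}$ with $f^{1/p^e}A\subseteq A^{1/p^e}$ split; ${\operatorname{fpt}}(A)=\sup\{\lambda\geq0:(A,\mathfrak{m}_A^\lambda)\text{ is }F\text{-pure}\}$. $I_e(R)=\{r\in R:\varphi(r^{1/p^e})\in\mathfrak{m}\text{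 for all }\varphi\in\operatorname{Hom}_R(R^{1/p^e},R)\}$; the splitting prime is $\mathcal{P}=\bigcap_e I_e(R)$ (a homogeneous prime ideal), and $\operatorname{sdim}(R)=\dim(R/\mathcal{P})$. The test ideal is $\tau=\bigcap_M\operatorname{ann}_R(0^*_M)$ over all $R$-modules $M$, where $0^*_M$ is the tight closure of $0$ in $M$: the set of $m\in M$ for which there is $c\in R$ not in any minimal prime with $c\otimes m=0$ in $F^e(M)=R^{(e)}\otimes_R M$ for all $e\gg0$ (here $R^{(e)}$ is $R$ viewed as a left module via the $e$-th Frobenius). $\tau$ and $\mathcal{P}$ are homogeneous compatible ideals. *)

(* Defs.v *)
From HB Require Import structures.
From mathcomp Require Import all_boot all_order all_algebra.
From mathcomp Require Import boolp classical_sets reals constructive_ereal ereal.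
Set Implicit Arguments. Unset Strict Implicit. Unset Printing Implicit Defensive.
Import Order.TTheory GRing.Theory Num.Theory.
Local Open Scope ring_scope.
Local Open Scope classical_set_scope.

Section Defs.
Variable A : comNzRingType.

Definition is_ideal (I : set A) : Prop :=
  I 0 /\ (forall x y, I x -> I y -> I (x + y)) /\ (forall r x, I x -> I (r * x)).

Definition prime_ideal (Q : set A) : Prop :=
  is_ideal Q /\ ~ Q 1 /\ (forall a b, Q (a * b) -> Q a \/ Q b).

Definition minimal_prime (Q : set A) : Prop :=
  prime_ideal Q /\ (forall Q', prime_ideal Q' -> Q' `<=` Q -> Q `<=` Q').

Definition ideal_gen (s : seq A) : set A :=
  fun x => exists c : nat -> A, x = \sum_(i < size s) c i * s`_i.

Definition noetherian : Prop :=
  forall I, is_ideal I -> exists s : seq A, I = ideal_gen s.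

Fixpoint ideal_pow (I : set A) (k : nat) : set A :=
  match k with
  | 0 => setT
  | k.+1 => fun x => exists (n : nat) (a b : nat -> A),
              (forall i, I (a i)) /\ (forall i, ideal_pow I k (b i)) /\
              x = \sum_(i < n) a i * b i
  end.

(* standard graded K-algebra structure with graded pieces G i, K = G 0 *)
Record std_graded (G : nat -> set A) : Prop := {
  sg_zero : forall i, G i 0;
  sg_sub : forall i x y, G i x -> G i y -> G i (x - y);
  sg_mul : forall i j x y, G i x -> G j y -> G (i + j)%N (x * y);
  sg_one : G 0 1;
  sg_decomp : forall x, exists (n : nat) (c : nat -> A),
                (forall i, G i (c i)) /\ x = \sum_(i < n) c i;
  sg_indep : forall (n : nat) (c : nat -> A), (forall i, G i (c i)) ->
                \sum_(i < n) c i = 0 -> forall i, (i < n)%N -> c i = 0;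
  sg_field : forall x, G 0 x -> x != 0 -> exists2 y, G 0 y & x * y = 1;
  (* R = K[R_1] : R_{i+1} = R_1 R_i *)
  sg_gen : forall i x, G i.+1 x -> exists (n : nat) (a b : nat -> A),
                (forall j, G 1 (a j)) /\ (forall j, G i (b j)) /\
                x = \sum_(j < n) a j * b j;
  sg_fin1 : exists s : seq A, (forall j, G 1 s`_j) /\
              forall x, G 1 x -> exists c : nat -> A, (forall j, G 0 (c j)) /\
                x = \sum_(j < size s) c j * s`_j
}.

Definition maxideal (G : nat -> set A) : set A :=
  fun x => exists (n : nat) (c : nat -> A),
    c 0%N = 0 /\ (forall i, G i (c i)) /\ x = \sum_(i < n) c i.

Definition homogeneous (G : nat -> set A) (J : set A) : Prop :=
  is_ideal J /\ forall (n : nat) (c : nat -> A), (forall i, G i (c i)) ->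
     J (\sum_(i < n) c i) -> forall i, (i < n)%N -> J (c i).

(* F-finite: [K : K^p] < oo, K = G 0 *)
Definition Ffinite (G : nat -> set A) (p : nat) : Prop :=
  exists s : seq A, (forall j, G 0 s`_j) /\
    forall k, G 0 k -> exists c : nat -> A, (forall j, G 0 (c j)) /\
      k = \sum_(j < size s) (c j) ^+ p * s`_j.

(* R-linear maps R^{1/p^e} -> R, identifying R^{1/p^e} with F^e_* R *)
Definition plinear (p e : nat) (phi : A -> A) : Prop :=
  (forall x y, phi (x + y) = phi x + phi y) /\
  (forall r x, phi (r ^+ (p ^ e) * x) = r * phi x).

Definition Fpure (p : nat) : Prop := exists phi, plinear p 1 phi /\ phi 1 = 1.

Definition compatible (p : nat) (J : set A) : Prop :=
  forall e phi, plinear p e phi -> forall x, J x -> J (phi x).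

(* (R/J)-linear maps (R/J)^{1/p^e} -> R/J, represented by lifts A -> A *)
Definition plinear_mod (J : set A) (p e : nat) (psi : A -> A) : Prop :=
  (forall x, J x -> J (psi x)) /\
  (forall x y, J (psi (x + y) - (psi x + psi y))) /\
  (forall r x, J (psi (r ^+ (p ^ e) * x) - r * psi x)).

Definition Fpure_pair (Rr : realType) (G : nat -> set A) (p : nat) (J : set A)
  (l : Rr) : Prop :=
  exists e0 : nat, forall e : nat, (e0 <= e)%N ->
    exists f, ideal_pow (maxideal G) (Num.truncn (((p ^ e)%N.-1)%:R * l)) f /\
      exists psi, plinear_mod J p e psi /\ J (psi f - 1).

(* fpt(R/J); fpt(R) is fpt_quot ... [set 0] *)
Definition fpt_quot (Rr : realType) (G : nat -> set A) (p : nat) (J : set A)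
  : \bar Rr :=
  ereal_sup [set l%:E | l in [set l : Rr | 0 <= l /\ Fpure_pair G p J l]].

Definition Ie (G : nat -> set A) (p e : nat) : set A :=
  fun r => forall phi, plinear p e phi -> maxideal G (phi r).
Definition splitting_prime (G : nat -> set A) (p : nat) : set A :=
  fun r => forall e, Ie G p e r.

Definition krull_dim_quot (Rr : realType) (P : set A) : \bar Rr :=
  ereal_sup [set (n%:R : Rr)%:E | n in [set n : nat | exists Q : nat -> set A,
     (forall i, prime_ideal (Q i)) /\ P `<=` Q 0%N /\
     (forall i, (i < n)%N -> Q i `<` Q i.+1)]].

Definition sdim (Rr : realType) (G : nat -> set A) (p : nat) : \bar Rr :=
  krull_dim_quot Rr (splitting_prime G p).

(* c (x) m = 0 in F^e(M) = R^(e) (x)_R M, via the universal property: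
   every R-balanced biadditive map B : R^(e) x M -> N kills (c, m);
   balanced means B (s * r^(p^e)) m = B s (r *: m). *)
Definition frob_tensor_zero (M : lmodType A) (p e : nat) (c : A) (m : M) : Prop :=
  forall (N : zmodType) (B : A -> M -> N),
    (forall s s' m', B (s + s') m' = B s m' + B s' m') ->
    (forall s m' m'', B s (m' + m'') = B s m' + B s m'') ->
    (forall s r m', B (s * r ^+ (p ^ e)) m' = B s (r *: m')) ->
    B c m = 0.

Definition tight_closure0 (M : lmodType A) (p : nat) : set M :=
  fun m => exists c : A, (forall Q, minimal_prime Q -> ~ Q c) /\
    exists e0 : nat, forall e, (e0 <= e)%N -> frob_tensor_zero p e c m.

Definition test_ideal (p : nat) : set A :=
  fun x => forall (M : lmodType A) (m : M), tight_closure0 p m -> x *: m = 0.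

End Defs.

(* Main.v *)
Require Import Defs.
From HB Require Import structures.
From mathcomp Require Import all_boot all_order all_algebra.
From mathcomp Require Import boolp classical_sets reals constructive_ereal ereal.
From mathcomp Require Import zify.
Set Implicit Arguments. Unset Strict Implicit. Unset Printing Implicit Defensive.
Import Order.TTheory GRing.Theory Num.Theory.
Local Open Scope ring_scope.
Local Open Scope classical_set_scope.

(** If [J] is compatible, every R-linear map R^{1/p^e} -> R descends to R/J, so a
    splitting for (R, m^l) induces one for (R/J, m^l).  The test ideal and the
    splitting prime are compatible, which gives the first three inequalities.

    For the last one, a map (R/P)^{1/p^e} -> R/P taking the value 1 on some f in m^N
    forces f to lie outside P + m^{[q]}, where q = p^e.  It therefore suffices that the
    top degree of R/(I + m^{[q]}) is at most q dim(R/I) + C, with C depending only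
    on the homogeneous ideal I.  This goes by Noetherian induction on I.  If ab
    lies in I with a, b homogeneous and outside I, use I + (a) and (I : a).  If I
    is prime, choose a linear form x outside I: R/(I + (x)) has smaller dimension,
    and R/(I + (x^q)) is filtered by q shifted copies of it. *)

(** * Ideals: sums with a principal ideal, colons, Noetherian induction *)

Section Ideals.
Variable A : comNzRingType.
Implicit Types (I J : set A) (x y a b : A).

Lemma idealN I x : is_ideal I -> I x -> I (- x).
Proof. by move=> [_ [_ IM]] Ix; rewrite -mulN1r; apply: IM. Qed.

Lemma idealB I x y : is_ideal I -> I x -> I y -> I (x - y).
Proof. by move=> II Ix Iy; apply: II.2.1 => //; apply: idealN. Qed.

Lemma ideal_sum I n (F : 'I_n -> A) :
  is_ideal I -> (forall i, I (F i)) -> I (\sum_i F i).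
Proof.
by move=> [I0 [ID _]] IF; elim/big_ind: _ => // x y; exact: ID.
Qed.

Definition ideal_add I a : set A := [set x | exists y v, I y /\ x = y + a * v].

Definition ideal_colon I a : set A := [set x | I (a * x)].

Lemma ideal_addP I a : is_ideal I -> is_ideal (ideal_add I a).
Proof.
move=> [I0 [ID IM]]; split; first by exists 0, 0; rewrite mulr0 addr0.
split=> [_ _ [y [v [Iy ->]]] [y' [v' [Iy' ->]]] | r _ [y [v [Iy ->]]]].
  by exists (y + y'), (v + v'); split; [exact: ID | rewrite mulrDr addrACA].
by exists (r * y), (r * v); split; [exact: IM | rewrite mulrDr mulrCA].
Qed.

Lemma ideal_colonP I a : is_ideal I -> is_ideal (ideal_colon I a).
Proof.
move=> [I0 [ID IM]]; split; first by rewrite /ideal_colon /= mulr0.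
split=> [x y Ix Iy | r x Ix]; rewrite /ideal_colon /=.
  by rewrite mulrDr; exact: ID.
by rewrite mulrCA; exact: IM.
Qed.

Lemma sub_ideal_add I a : I `<=` ideal_add I a.
Proof. by move=> x Ix; exists x, 0; rewrite mulr0 addr0. Qed.

Lemma mem_ideal_add I a : is_ideal I -> ideal_add I a a.
Proof. by move=> [I0 _]; exists 0, 1; rewrite mulr1 add0r. Qed.

Lemma sub_ideal_colon I a : is_ideal I -> I `<=` ideal_colon I a.
Proof. by move=> [_ [_ IM]] x Ix; exact: IM. Qed.

Lemma ideal_gen_nth (s : seq A) i : (i < size s)%N -> ideal_gen s s`_i.
Proof.
move=> lt_is; exists (fun j => (j == i)%:R).
rewrite (bigD1 (Ordinal lt_is)) //= eqxx mul1r big1 ?addr0 // => j neq_ji.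
by rewrite -[_ == _ :> nat]/(j == Ordinal lt_is) (negbTE neq_ji) mul0r.
Qed.

(** Every counterexample has a strictly larger one, so choice yields an infinite ascending chain of
    them; its union is finitely generated. *)
Lemma noetherian_ind (P : set A -> Prop) : noetherian A ->
  (forall I, is_ideal I ->
     (forall J, is_ideal J -> I `<` J -> P J) -> P I) ->
  forall I, is_ideal I -> P I.
Proof.
move=> noethA IH I0 idI0; apply: contrapT => nPI0.
pose T := {I : set A | is_ideal I /\ ~ P I}.
have /choice[f fP] : forall I : T, exists J : T, sval I `<` sval J.
  move=> [I [idI nPI]] /=; apply: contrapT => noJ; apply: nPI.
  apply: IH => // J idJ IJ; apply: contrapT => nPJ; apply: noJ.
  by exists (exist _ J (conj idJ nPJ)).
pose S n := sval (iter n f (exist _ I0 (conj idI0 nPI0))).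
have idS n : is_ideal (S n) by rewrite /S; case: (iter _ _ _) => I [].
have S_lt n : S n `<` S n.+1 by exact: fP.
have S_le m n : (m <= n)%N -> S m `<=` S n.
  move=> /subnK <-; elim: (n - m)%N => [//|k IHk] x Smx.
  by rewrite addSn; apply: (S_lt _).1; exact: IHk.
pose U : set A := [set x | exists n, S n x].
have idU : is_ideal U.
  split; first by exists 0%N; exact: (idS 0%N).1.
  split=> [x y [m Sx] [n Sy] | r x [n Sx]].
    exists (maxn m n); apply: (idS _).2.1.
      by apply: S_le Sx; exact: leq_maxl.
    by apply: S_le Sy; exact: leq_maxr.
  by exists n; apply: (idS n).2.2.
have [s Us] := noethA U idU.
have /choice[N NP] : forall i : 'I_(size s), exists n, S n s`_i.
  by move=> i; have := ideal_gen_nth (ltn_ord i); rewrite -Us.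
(* All generators of the union lie in the member of index [\max_i N i], so the chain cannot grow
   there. *)
have [_ []] := S_lt (\max_i N i)%N => x Sx.
have : U x by exists (\max_i N i).+1.
rewrite Us => -[c ->]; apply: ideal_sum => // i; apply: (idS _).2.2.
by apply: (S_le (N i)); [exact: leq_bigmax | exact: NP].
Qed.

End Ideals.

(** * Homogeneous components in a graded ring *)

Section Grading.
Variables (A : comNzRingType) (G : nat -> set A).
Hypothesis sgG : std_graded G.
Implicit Types (I J T : set A) (x y a b r : A) (c : nat -> A).

(** Requiring [c] to vanish beyond the summation bound makes it unique as a function on all of
    [nat]. *)
Definition hdecomp x : set (nat -> A) := [set c | (forall i, G i (c i)) /\
  exists n, (forall i, (n <= i)%N -> c i = 0) /\ x = \sum_(i < n) c i].

Definition hpart x : nat -> A := xget (fun=> 0) (hdecomp x).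

Lemma sum_ord_widen c m n : (m <= n)%N -> (forall i, (m <= i)%N -> c i = 0) ->
  \sum_(i < m) c i = \sum_(i < n) c i.
Proof.
move=> le_mn c0; rewrite -!(big_mkord xpredT) (big_cat_nat _ le_mn) //=.
by rewrite [X in _ = _ + X]big_nat_cond [X in _ = _ + X]big1 ?addr0 // => i /andP[/andP[/c0]].
Qed.

Lemma G_add i x y : G i x -> G i y -> G i (x + y).
Proof.
move=> Gx Gy; rewrite -[y]opprK; apply: sg_sub => //.
by rewrite -sub0r; apply: sg_sub => //; exact: sg_zero.
Qed.

Lemma G_exp i x n : G i x -> G (i * n)%N (x ^+ n).
Proof.
move=> Gx; elim: n => [|n IHn]; first by rewrite muln0 expr0; exact: sg_one.
by rewrite mulnS exprS; apply: sg_mul.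
Qed.

Lemma hdecomp_uniq x c c' : hdecomp x c -> hdecomp x c' -> c = c'.
Proof.
move=> [Gc [m [c0 xc]]] [Gc' [n [c'0 xc']]]; apply/funext => i.
have := leqP (maxn m n) i; case; first by rewrite geq_max => /andP[/c0-> /c'0->].
move=> lt_i; apply/subr0_eq; apply: (sg_indep sgG (n := maxn m n)
  (c := fun i => c i - c' i)) => // [j|]; first exact: sg_sub.
by rewrite sumrB -(sum_ord_widen (leq_maxl m n)) // -(sum_ord_widen (leq_maxr m n)) //
  -xc -xc' subrr.
Qed.

Lemma hpartP x : hdecomp x (hpart x).
Proof.
rewrite /hpart; case: xgetP => [c _ //|] no.
have [n [c [Gc xc]]] := sg_decomp sgG x; case: (no (fun i => if (i < n)%N then c i else 0)).
split=> [i|]; first by case: ifP => _; [exact: Gc | exact: sg_zero].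
exists n; split=> [i|]; first by rewrite leqNgt => /negbTE->.
by rewrite xc; apply: eq_bigr => i _; rewrite ltn_ord.
Qed.

Lemma hpart_uniq x c : hdecomp x c -> hpart x = c.
Proof. by move=> xc; apply: hdecomp_uniq xc; exact: hpartP. Qed.

Lemma hpart_in x i : G i (hpart x i).
Proof. exact: (hpartP x).1. Qed.

Lemma hpart_inj x y : hpart x =1 hpart y -> x = y.
Proof.
move=> /funext eq_xy; have [_ [m [x0 ->]]] := hpartP x.
have [_ [n [y0 ->]]] := hpartP y; rewrite eq_xy in x0 *.
by rewrite (sum_ord_widen (leq_maxl m n)) // (sum_ord_widen (leq_maxr m n)).
Qed.

Lemma hpart_ex c n : (forall i, G i (c i)) -> (forall i, (n <= i)%N -> c i = 0) ->
  exists x, hpart x = c.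
Proof. by move=> Gc c0; exists (\sum_(i < n) c i); apply: hpart_uniq; split=> //; exists n. Qed.

Lemma hpartD x y i : hpart (x + y) i = hpart x i + hpart y i.
Proof.
suff -> : hpart (x + y) = fun i => hpart x i + hpart y i by [].
apply: hpart_uniq; split=> [j|]; first by apply: G_add; exact: hpart_in.
have [[_ [m [x0 xE]]] [_ [n [y0 yE]]]] := (hpartP x, hpartP y).
exists (maxn m n); split=> [j|]; first by rewrite geq_max => /andP[/x0-> /y0->]; rewrite addr0.
by rewrite big_split /= -(sum_ord_widen (leq_maxl m n)) //
  -(sum_ord_widen (leq_maxr m n)) // -xE -yE.
Qed.

Lemma hpart0 i : hpart 0 i = 0.
Proof.
suff -> : hpart 0 = fun=> 0 by [].
by apply: hpart_uniq; split=> [j|]; [exact: (sg_zero sgG) | exists 0%N; rewrite big_ord0].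
Qed.

Lemma hpart_sum n (F : 'I_n -> A) i : hpart (\sum_j F j) i = \sum_j hpart (F j) i.
Proof. by apply: (big_morph (hpart^~ i)) => [x y|]; [exact: hpartD | exact: hpart0]. Qed.

Lemma hpart_homog i x j : G i x -> hpart x j = if j == i then x else 0.
Proof.
move=> Gx; suff -> : hpart x = fun j => if j == i then x else 0 by [].
apply: hpart_uniq; split=> [k|]; first by case: eqP => [->|_] //; exact: sg_zero.
exists i.+1; split=> [k lt_ik|]; first by rewrite gtn_eqF.
rewrite big_ord_recr /= eqxx big1 ?add0r // => k _.
by rewrite ltn_eqF ?ltn_ord.
Qed.

Lemma hpartM_homog k r x j : G k r ->
  hpart (r * x) j = if (k <= j)%N then r * hpart x (j - k) else 0.
Proof.
move=> Gr; have [_ [n [x0 xE]]] := hpartP x.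
rewrite {1}xE mulr_sumr hpart_sum.
under eq_bigr => i _ do rewrite (hpart_homog _ (sg_mul sgG Gr (hpart_in x i))).
case: leqP => [le_kj|lt_jk]; last first.
  by rewrite big1 // => i _; rewrite ltn_eqF // ltn_addr.
case: (ltnP (j - k) n) => [lt_n|le_n]; last first.
  rewrite x0 // mulr0 big1 // => i _; case: eqP => // jE.
  by move: le_n; rewrite jE addKn leqNgt ltn_ord.
rewrite (bigD1 (Ordinal lt_n)) //= subnKC // eqxx big1 ?addr0 // => i neq.
by case: eqP => // jE; case/eqP: neq; apply: val_inj => /=; rewrite jE addKn.
Qed.

Lemma hpart_sumE x n : (forall i, (n <= i)%N -> hpart x i = 0) ->
  x = \sum_(i < n) hpart x i.
Proof.
move=> x0; have [_ [m [x0' {1}->]]] := hpartP x.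
by rewrite (sum_ord_widen (leq_maxl m n)) // (sum_ord_widen (leq_maxr m n)).
Qed.

Lemma hpart_sum_homog n c i : (forall j, G j (c j)) -> (i < n)%N ->
  hpart (\sum_(j < n) c j) i = c i.
Proof.
move=> Gc lt_in; rewrite hpart_sum (bigD1 (Ordinal lt_in)) //=.
rewrite (hpart_homog _ (Gc i)) eqxx big1 ?addr0 // => j neq_ji.
rewrite (hpart_homog _ (Gc j)); case: eqP => // ij.
by case/eqP: neq_ji; exact: val_inj.
Qed.

(** * Homogeneous ideals *)

Lemma homog_ideal_ind I x : is_ideal I -> (forall i, I (hpart x i)) -> I x.
Proof.
move=> idI Ix; have [_ [n [_ ->]]] := hpartP x.
exact: ideal_sum.
Qed.

Lemma homogeneous_hpart J :
  homogeneous G J <-> is_ideal J /\ forall x i, J x -> J (hpart x i).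
Proof.
split=> -[idJ hJ]; split=> //.
  move=> x i Jx; have [Gx [n [x0 xE]]] := hpartP x.
  have [/x0->|lt_in] := leqP n i; first exact: idJ.1.
  by apply: hJ lt_in => //; rewrite -xE.
by move=> n c Gc Jc i lt_in; rewrite -(hpart_sum_homog Gc lt_in); exact: hJ.
Qed.

Lemma homogeneous_add k a I : G k a -> homogeneous G I ->
  homogeneous G (ideal_add I a).
Proof.
move=> Ga /homogeneous_hpart[idI hI]; apply/homogeneous_hpart.
split=> [|_ i [y [v [Iy ->]]]]; first exact: ideal_addP.
rewrite hpartD (hpartM_homog _ _ Ga).
exists (hpart y i), (if (k <= i)%N then hpart v (i - k) else 0).
by split; [exact: hI | case: ifP; rewrite ?mulr0].
Qed.

Lemma homogeneous_colon k a I : G k a -> homogeneous G I ->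
  homogeneous G (ideal_colon I a).
Proof.
move=> Ga /homogeneous_hpart[idI hI]; apply/homogeneous_hpart.
split=> [|x i Ix]; first exact: ideal_colonP.
have := hI _ (k + i)%N Ix.
by rewrite (hpartM_homog _ _ Ga) leq_addr addKn.
Qed.

(** In the degree-[n] part of [y + a * v], only the component of [v] in degree [n - k] is left. *)
Lemma ideal_add_homog k a n x I : G k a -> homogeneous G I -> (k <= n)%N ->
  G n x -> ideal_add I a x -> exists y v, [/\ I y, G (n - k)%N v & x = y + a * v].
Proof.
move=> Ga /homogeneous_hpart[_ hI] le_kn Gx [y [v [Iy xE]]].
exists (hpart y n), (hpart v (n - k)); split; [exact: hI | exact: hpart_in |].
have := hpart_homog n Gx; rewrite eqxx => <-.
by rewrite xE hpartD (hpartM_homog _ _ Ga) le_kn.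
Qed.

(** For an ideal [I], this is the largest homogeneous ideal inside it; it lets the degree bound
    reach ideals that need not be homogeneous. *)
Definition homog_core I : set A := [set x | forall i, I (hpart x i)].

Lemma homogeneous_core I : is_ideal I -> homogeneous G (homog_core I).
Proof.
move=> idI; have [I0 [ID IM]] := idI; apply/homogeneous_hpart; split; last first.
  move=> x i Ix j; rewrite (hpart_homog _ (hpart_in x i)).
  by case: eqP => // _; exact: Ix.
split; first by move=> i; rewrite hpart0.
split=> [x y Ix Iy i | r x Ix i]; first by rewrite hpartD; exact: ID.
have [_ [n [_ ->]]] := hpartP r; rewrite mulr_suml hpart_sum.
apply: ideal_sum => // j; rewrite (hpartM_homog _ _ (hpart_in r j)).
by case: ifP => _ //; exact: IM.
Qed.

(** * The homogeneous maximal ideal and homogeneous primes *)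

Lemma maxidealE x : maxideal G x <-> hpart x 0 = 0.
Proof.
split=> [[[|n] [c [c0 [Gc ->]]]]|x0]; first by rewrite big_ord0 hpart0.
  by rewrite hpart_sum_homog.
by have [Gx [n [_ xE]]] := hpartP x; exists n, (hpart x).
Qed.

Lemma hpart0M x y : hpart (x * y) 0 = hpart x 0 * hpart y 0.
Proof.
have [_ [n [x0 {1}->]]] := hpartP x; rewrite mulr_suml hpart_sum.
under eq_bigr => j _ do rewrite (hpartM_homog _ _ (hpart_in x j)).
case: n x0 => [x0|n _]; first by rewrite big_ord0 x0 ?mul0r.
by rewrite big_ord_recl /= subn0 big1 ?addr0.
Qed.

Lemma hpart1_0 : hpart 1 0 = 1.
Proof. by rewrite (hpart_homog _ (sg_one sgG)) eqxx. Qed.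

(** Taking the degree-zero component is multiplicative, with values in the field [G 0]. *)
Lemma maxideal_prime : prime_ideal (maxideal G).
Proof.
split; last split.
- split; first by apply/maxidealE; exact: hpart0.
  split=> [x y /maxidealE x0 /maxidealE y0 | r x /maxidealE x0]; apply/maxidealE.
    by rewrite hpartD x0 y0 addr0.
  by rewrite hpart0M x0 mulr0.
- by move=> /maxidealE; rewrite hpart1_0 => /eqP; rewrite oner_eq0.
- move=> x y /maxidealE; rewrite hpart0M => xy0.
  have [x0|x_neq0] := eqVneq (hpart x 0) 0; first by left; apply/maxidealE.
  right; apply/maxidealE; have [z _ xz1] := sg_field sgG (hpart_in x 0) x_neq0.
  by rewrite -[LHS]mul1r -xz1 mulrAC xy0 mul0r.
Qed.

Lemma sub_maxideal I : homogeneous G I -> ~ I 1 -> I `<=` maxideal G.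
Proof.
move=> /homogeneous_hpart[[_ [_ IM]] hI] nI1 x Ix; apply/maxidealE.
apply: contrapT => /eqP x_neq0; apply: nI1.
have [z _ <-] := sg_field sgG (hpart_in x 0) x_neq0.
by rewrite mulrC; apply: IM; exact: hI.
Qed.

Lemma maxideal_homog n x : (0 < n)%N -> G n x -> maxideal G x.
Proof.
by move=> n_gt0 Gx; apply/maxidealE; rewrite (hpart_homog _ Gx) ltn_eqF.
Qed.

Lemma hpartM_top m n x y : (forall i, (m < i)%N -> hpart x i = 0) ->
  (forall i, (n < i)%N -> hpart y i = 0) ->
  hpart (x * y) (m + n) = hpart x m * hpart y n.
Proof.
move=> x0 y0; rewrite {1}(hpart_sumE x0) mulr_suml hpart_sum big_ord_recr /=.
rewrite (hpartM_homog _ _ (hpart_in x m)) leq_addr addKn big1 ?add0r // => i _.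
rewrite (hpartM_homog _ _ (hpart_in x i)); case: ifP => // _.
by rewrite y0 ?mulr0 //; have := ltn_ord i; lia.
Qed.

(** Leading forms: the product of the top components of [x] and [y] is a component of [x * y], so
    one of the two lies in [I]; subtract it and induct. *)
Lemma homog_prime I : homogeneous G I -> ~ I 1 ->
  (forall i j a b, G i a -> G j b -> I (a * b) -> I a \/ I b) -> prime_ideal I.
Proof.
move=> /homogeneous_hpart[idI hI] nI1 homogP; split=> //; split=> // x y.
have [_ [m [x0 _]]] := hpartP x; have [_ [n [y0 _]]] := hpartP y.
have vanish z : (forall i, (0 <= i)%N -> hpart z i = 0) -> I z.
  by move=> z0; rewrite (hpart_sumE z0) big_ord0; exact: idI.1.
have split_top k z : (forall i, (k < i)%N -> hpart z i = 0) ->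
    forall i, (k <= i)%N -> hpart (z - hpart z k) i = 0.
  move=> z0 i le_ki; apply: (addIr (hpart (hpart z k) i)).
  rewrite -hpartD subrK add0r (hpart_homog _ (hpart_in z k)).
  by case: eqP => [->//|/eqP neq]; apply: z0; rewrite ltn_neqAle eq_sym neq.
(* The bounds are exclusive: a zero bound means a zero element, and removing a top component lowers
   one bound by 1. *)
have [s] := ubnP (m + n); elim: s m n x y x0 y0 => // s IHs m n x y x0 y0.
case: m x0 => [x0 _ _|m x0]; first by left; exact: vanish.
case: n y0 => [y0 _ _|n y0]; first by right; exact: vanish.
rewrite ltnS => le_s Ixy.
have [] := homogP _ _ _ _ (hpart_in x m) (hpart_in y n).
- by rewrite -hpartM_top //; exact: hI.
- move=> Ixm; have [||||Ix|Iy] := IHs m n.+1 (x - hpart x m) y; try by [].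
  + exact: split_top.
  + by rewrite mulrBl; apply: idealB => //; rewrite mulrC; exact: idI.2.2.
  + by left; rewrite -(subrK (hpart x m) x); exact: idI.2.1.
  + by right.
- move=> Iyn; have [||||Ix|Iy] := IHs m.+1 n x (y - hpart y n); try by [].
  + exact: split_top.
  + by move: le_s; lia.
  + by rewrite mulrBr; apply: idealB => //; exact: idI.2.2.
  + by left.
  + by right; rewrite -(subrK (hpart y n) y); exact: idI.2.1.
Qed.

Lemma homog_sub_ideal I n x : is_ideal I -> G 1 `<=` I -> (0 < n)%N -> G n x -> I x.
Proof.
case: n => // n idI G1I _ /(sg_gen sgG)[k [a [b [Ga [_ ->]]]]].
by apply: ideal_sum => // j; rewrite mulrC; apply: idI.2.2; exact: G1I.
Qed.

Lemma hpart_ideal_pow k x i :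
  ideal_pow (maxideal G) k x -> (i < k)%N -> hpart x i = 0.
Proof.
elim: k x i => // k IHk x i [n [a [b [ma [mb ->]]]]] lt_ik.
rewrite hpart_sum big1 // => j _; have [_ [m [_ ->]]] := hpartP (a j).
rewrite mulr_suml hpart_sum big1 // => l _.
rewrite (hpartM_homog _ _ (hpart_in (a j) l)); case: ifP => // le_li.
have [l0|l_gt0] := posnP l; first by rewrite l0 (maxidealE _).1 ?mul0r.
by rewrite (IHk (b j) _ (mb j)) ?mulr0 //; lia.
Qed.

(** * Chains of primes and the degree bound *)

Definition prime_chain I n := exists Q : nat -> set A,
  (forall i, prime_ideal (Q i)) /\ I `<=` Q 0%N /\
  (forall i, (i < n)%N -> Q i `<` Q i.+1).

Lemma prime_chain_sub I J n : I `<=` J -> prime_chain J n -> prime_chain I n.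
Proof.
move=> IJ [Q [Qp [JQ Qlt]]]; exists Q; split=> //; split=> //.
exact: subset_trans JQ.
Qed.

(** With [I] placed below the chain, [a] witnesses strictness of the first inclusion; this gives the
    drop in dimension when [a] is added to a prime. *)
Lemma prime_chain_cons I a n : prime_ideal I -> ~ I a ->
  prime_chain (ideal_add I a) n -> prime_chain I n.+1.
Proof.
move=> Ip nIa [Q [Qp [IQ Qlt]]].
exists (fun i => if i is j.+1 then Q j else I).
split=> [[|i] //|]; split=> // -[_|i]; last by rewrite ltnS; exact: Qlt.
split; first by move=> x Ix; apply: IQ; exact: sub_ideal_add.
by move=> QI; apply: nIa; apply: QI; apply: IQ; apply: mem_ideal_add Ip.1.
Qed.

(* [T] plays the role of I + m^{[q]}, but is arbitrary, so that the induction
   hypothesis also applies to colon ideals of [T]. *)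
Lemma homog_degree_bound : noetherian A -> forall I, is_ideal I ->
  homogeneous G I -> forall d, (forall n, prime_chain I n -> (n <= d)%N) ->
  exists C, forall q T, homogeneous G T -> I `<=` T ->
    (forall y, G 1 y -> T (y ^+ q)) ->
    forall n x, (d * q + C <= n)%N -> G n x -> T x.
Proof.
move=> noethA; apply: (noetherian_ind noethA) => I idI IH hI d dimI.
have [I1|nI1] := pselect (I 1).
  exists 0%N => q T [idT _] IT _ n x _ _.
  by rewrite -[x]mulr1; apply: idT.2.2; exact: IT.
have [Ip|nIp] := pselect (prime_ideal I); last first.
  have [i [j [a [b [Ga Gb Iab nIa nIb]]]]] : exists i j a b,
      [/\ G i a, G j b, I (a * b), ~ I a & ~ I b].
    apply: contrapT => no; apply: nIp; apply: homog_prime => // i j a b Ga Gb Iab.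
    apply: contrapT => /not_orP[nIa nIb]; apply: no.
    by exists i, j, a, b.
  have [|||n IJn|C1 C1P] := IH (ideal_add I a) _ _ _ d.
  - exact: ideal_addP.
  - split; first exact: sub_ideal_add.
    by move=> /(_ a (mem_ideal_add _ idI)).
  - exact: homogeneous_add Ga hI.
  - by apply: dimI; apply: prime_chain_sub IJn; exact: sub_ideal_add.
  have [|||n IJn|C2 C2P] := IH (ideal_colon I a) _ _ _ d.
  - exact: ideal_colonP.
  - split; first exact: sub_ideal_colon.
    by move=> /(_ b Iab).
  - exact: homogeneous_colon Ga hI.
  - by apply: dimI; apply: prime_chain_sub IJn; exact: sub_ideal_colon.
  (* [C1] puts [x] in [T] plus the multiples of [a]; the cofactor [v] then has degree [n - i], hence
     the shift of [C2] by [i]. *)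
  exists (maxn C1 (C2 + i)) => q T hT IT Tq n x le_n Gx; have [idT _] := hT.
  have [|||y [v [Ty Gv ->]]] := @ideal_add_homog i a n x T Ga hT; try by [].
  - by lia.
  - apply: (C1P q _ (homogeneous_add Ga hT)) Gx; last by lia.
      by move=> _ [y [v [/IT Ty ->]]]; exists y, v.
    by move=> y /Tq; exact: sub_ideal_add.
  apply: idT.2.1 => //.
  apply: (C2P q _ (homogeneous_colon Ga hT)) Gv; last by lia.
    by move=> z /IT.
  by move=> z /Tq; exact: sub_ideal_colon.
(* In this case the quotient by [I] lives in degree 0 only, so the constant 1 works. *)
have [G1I|] := pselect (G 1 `<=` I).
  exists 1%N => q T [idT _] IT _ n x le_n; apply: homog_sub_ideal => //; last by lia.
  exact: subset_trans IT.
move=> /existsNP[a /not_implyP[Ga nIa]].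
(* The chain from [I] to the maximal ideal has length 1, so [d] is a successor. *)
have d_gt0 : (0 < d)%N.
  apply: dimI; exists (fun i => if i is 0 then I else maxideal G).
  split=> [[|i] //|]; first exact: maxideal_prime.
  split=> // -[|//] _; split; first exact: sub_maxideal.
  by move=> mI; apply: nIa; apply: mI; exact: maxideal_homog Ga.
case: d => // d in dimI d_gt0 *.
have [|||n Jn|C CP] := IH (ideal_add I a) _ _ _ d.
- exact: ideal_addP.
- split; first exact: sub_ideal_add.
  by move=> /(_ a (mem_ideal_add _ idI)).
- exact: homogeneous_add Ga hI.
- by have := dimI _ (prime_chain_cons Ip nIa Jn).
exists C.+1 => q T hT IT Tq; have [idT _] := hT.
(* Each of the [q] steps removes one factor [a] at the cost of one degree: [k = 0] holds because
   [a ^+ q] lies in [T], and [k = q] is the claim. *)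
suff key k n x : (k <= q)%N -> (d * q + k + C.+1 <= n)%N -> G n x ->
    T (a ^+ (q - k) * x).
  move=> n x le_n Gx; have := key q n x; rewrite subnn expr0 mul1r; apply=> //.
  by move: le_n; rewrite mulSn; lia.
elim: k n x => [|k IHk] n x le_kq le_n Gx.
  by rewrite subn0 mulrC; apply: idT.2.2; exact: Tq.
have Gak := G_exp (q - k.+1) Ga.
(* This colon ideal again contains [I] and the [q]-th powers of linear forms, so the bound for
   [ideal_add I a] applies to its sum with the multiples of [a]. *)
have hTk := homogeneous_colon Gak hT.
have [|||y [v [Ty Gv ->]]] := @ideal_add_homog 1 a n x _ Ga hTk; try by [].
- by lia.
- apply: (CP q _ (homogeneous_add Ga hTk)) Gx; last by lia.
    move=> _ [y [v [/IT Ty ->]]]; exists y, v; split=> //.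
    exact: sub_ideal_colon.
  by move=> y /Tq Ty; apply: sub_ideal_add; exact: sub_ideal_colon.
rewrite mulrDr; apply: idT.2.1 => //.
rewrite mulrA -exprSr subnSK //; apply: IHk Gv; [exact: ltnW | lia].
Qed.

(** If [l] exceeded the dimension [d], then for large q = p^e the exponent of the power containing
    [f] would pass d q + C, and [psi] would send [f] into the maximal ideal rather than to 1 modulo
    [J]. *)
Lemma fpt_quot_le_dim (Rr : realType) (p : nat) J : prime p -> noetherian A ->
  homogeneous G J -> J `<=` maxideal G ->
  (fpt_quot Rr G p J <= krull_dim_quot Rr J)%E.
Proof.
move=> p_pr noethA hJ Jm; have [idJ _] := hJ.
have [[m0 [mD mM]] [m1 _]] := maxideal_prime.
apply: ge_ereal_sup => _ [l [l_ge0 [e0 lP]] <-].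
rewrite leNgt; apply/negP => dim_lt.
have chain_lt n : prime_chain J n -> n%:R < l.
  move=> Jn; rewrite -lte_fin; apply: le_lt_trans dim_lt.
  by apply: ereal_sup_ubound; exists n.
(* All chain lengths are below [l], so there is a maximal one [d], and [d] is below [l] too. *)
have [|n|d /asboolP/chain_lt lt_dl dmax] :=
    @ex_maxnP (fun n => `[< prime_chain J n >]) (Num.truncn l).
- exists 0%N; apply/asboolP; exists (fun=> maxideal G).
  by split=> [_|]; [exact: maxideal_prime | split].
- by move=> /asboolP/chain_lt/ltW; rewrite truncn_ge_nat.
have [|C CP] := homog_degree_bound noethA idJ hJ (d := d).
  by move=> n Jn; apply: dmax; apply/asboolP.
(* With q = p^e, the inequality d q + C <= (q - 1) l amounts to d + C <= (q - 1)(l - d), and q - 1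
   >= e. *)
pose e := maxn e0 (Num.bound ((d + C)%:R / (l - d%:R))).
have [f [fpow [psi [[psiJ [psiD psiM]] psi1]]]] := lP e (leq_maxl _ _).
have large : (d * p ^ e + C <= Num.truncn ((p ^ e).-1%:R * l))%N.
  have pe_gt0 : (0 < p ^ e)%N by rewrite expn_gt0 prime_gt0.
  have ld_gt0 : 0 < l - d%:R by rewrite subr_gt0.
  rewrite truncn_ge_nat ?mulr_ge0 //.
  have -> : (d * p ^ e + C)%:R = (d + C)%:R + (p ^ e).-1%:R * d%:R :> Rr.
    rewrite -natrM -natrD; congr _%:R.
    by case: (p ^ e)%N pe_gt0 => // q _ /=; lia.
  rewrite -lerBrDr -mulrBr -ler_pdivrMr //.
  have /ltW := archi_boundP (divr_ge0 (ler0n Rr (d + C)) (ltW ld_gt0)).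
  move=> /le_trans; apply; rewrite ler_nat -ltnS prednK //.
  by apply: leq_trans (ltn_expl e (prime_gt1 p_pr)); rewrite ltnS leq_maxr.
(* The largest ideal that [psi] sends into the maximal ideal. As [psi] need not respect the grading,
   the degree bound is applied to its homogeneous core. *)
pose T0 : set A := [set x | forall r, maxideal G (psi (r * x))].
have mB x y : maxideal G y -> J (x - y) -> maxideal G x.
  by move=> my /Jm mxy; rewrite -(subrK y x); exact: mD.
have idT0 : is_ideal T0.
  split; first by move=> r; rewrite mulr0; apply/Jm/psiJ; exact: idJ.1.
  split=> [x y Tx Ty r | r x Tx s]; last by rewrite mulrA; exact: Tx.
  by rewrite mulrDr; apply: mB (psiD _ _); exact: mD.
have T0f : T0 f.
  apply: homog_ideal_ind => // i.
  have [/(hpart_ideal_pow fpow)->|le_i] := ltnP i (Num.truncn ((p ^ e).-1%:R * l)).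
    exact: idT0.1.
  suff : homog_core T0 (hpart f i).
    by move=> /(_ i); rewrite (hpart_homog _ (hpart_in f i)) eqxx.
  apply: (CP (p ^ e)%N _ (homogeneous_core idT0)) (hpart_in f i).
  - move=> x Jx j r; apply/Jm/psiJ/idJ.2.2.
    exact: ((homogeneous_hpart J).1 hJ).2.
  - move=> y Gy i'; rewrite (hpart_homog _ (G_exp _ Gy)).
    case: eqP => _; last exact: idT0.1.
    move=> r; rewrite mulrC; apply: mB (psiM _ _).
    by rewrite mulrC; apply: mM; exact: maxideal_homog Gy.
  - exact: leq_trans le_i.
apply: m1; rewrite -(subKr (psi f) 1); apply: (idealB (conj m0 (conj mD mM))).
  by have := T0f 1; rewrite mul1r.
exact: Jm.
Qed.

(** * Graded parts of maps R^{1/p^e} -> R and the splitting prime *)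

Lemma frobeniusD (p e : nat) x y : p \in [pchar A] ->
  (x + y) ^+ (p ^ e) = x ^+ (p ^ e) + y ^+ (p ^ e).
Proof.
move=> chAp; apply: exprDn_pchar; rewrite pnatX pnatE ?chAp //.
exact: pcharf_prime chAp.
Qed.

Lemma plinear0 p e phi : plinear p e phi -> phi 0 = 0 :> A.
Proof. by case=> phiD _; apply: (addIr (phi 0)); rewrite -phiD !add0r. Qed.

(* The degree-[i] part of [phi]: it sends degree [p^e j + i] to degree [j]. *)
Lemma plinear_hpart p e phi i : p \in [pchar A] -> plinear p e phi ->
  exists psi, plinear p e psi /\
    forall x j, hpart (psi x) j = hpart (phi (hpart x (p ^ e * j + i))) j.
Proof.
move=> chAp phi_lin; have [phiD phiM] := phi_lin.
have p_gt0 : (0 < p ^ e)%N by rewrite expn_gt0 prime_gt0 ?(pcharf_prime chAp).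
(* The prescribed components vanish for large [j] because p^e j + i >= j. *)
have /choice[psi psiE] : forall x, exists y,
    forall j, hpart y j = hpart (phi (hpart x (p ^ e * j + i))) j.
  move=> x; have [_ [n [x0 _]]] := hpartP x.
  have [||y yE] := @hpart_ex
    (fun j => hpart (phi (hpart x (p ^ e * j + i))) j) n.
  - by move=> j; exact: hpart_in.
  - move=> j le_nj; rewrite x0 ?(plinear0 phi_lin) ?hpart0 //.
    by rewrite (leq_trans le_nj) // (leq_trans _ (leq_addr _ _)) // leq_pmull.
  - by exists y => j; rewrite yE.
have psiD x y : psi (x + y) = psi x + psi y.
  by apply: hpart_inj => j; rewrite hpartD !psiE hpartD phiD hpartD.
have psi0 : psi 0 = 0.
  by apply: (addIr (psi 0)); rewrite -psiD !add0r.
exists psi; split=> //; split=> // r x; have [_ [n [_ ->]]] := hpartP r.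
(* Frobenius is additive, so both sides are additive in [r] and [r] may be taken homogeneous. *)
elim/big_ind: _ => [|r1 r2 IH1 IH2|k _].
- by rewrite expr0n eqn0Ngt p_gt0 !mul0r psi0.
- by rewrite frobeniusD // !mulrDl psiD IH1 IH2.
have Gr := hpart_in r k; set s := hpart r k in Gr *.
apply: hpart_inj => j; rewrite psiE (hpartM_homog _ _ Gr).
rewrite (hpartM_homog _ _ (G_exp _ Gr)).
case: (leqP k j) => [le_kj|lt_jk].
  rewrite ifT; last by rewrite mulnC (leq_trans _ (leq_addr _ _)) ?leq_mul2l ?le_kj ?orbT.
  rewrite phiM (hpartM_homog _ _ Gr) le_kj psiE; congr (s * hpart (phi (hpart x _)) _).
  by rewrite mulnBr [(k * _)%N]mulnC addnBAC // leq_mul2l le_kj orbT.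
(* The argument of [phi] may be nonzero here, but its image is a multiple of [s], which has degree
   [k], and so has no component in degree [j < k]. *)
case: ifP => _; last by rewrite (plinear0 phi_lin) hpart0.
by rewrite phiM (hpartM_homog _ _ Gr) leqNgt lt_jk.
Qed.

(** Membership tests only the degree-zero component of the values, and there the degree-[i] part of
    [phi] sees exactly the degree-[i] component of [x]. *)
Lemma homogeneous_splitting_prime p : p \in [pchar A] ->
  homogeneous G (splitting_prime G p).
Proof.
move=> chAp; have [[m0 [mD mM]] _] := maxideal_prime.
apply/homogeneous_hpart; split=> [|x i Px e phi phi_lin]; last first.
  have [psi [psi_lin psiE]] := plinear_hpart i chAp phi_lin.
  have /maxidealE := Px e psi psi_lin.
  by rewrite psiE muln0 add0n => phi0; apply/maxidealE.
split; first by move=> e phi /plinear0->.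
split=> [x y Px Py e phi phi_lin | r x Px e phi [phiD phiM]].
  by rewrite phi_lin.1; exact: mD (Px e phi phi_lin) (Py e phi phi_lin).
apply: (Px e (fun x => phi (r * x))); split=> [y z|s y].
  by rewrite mulrDr phiD.
by rewrite mulrCA phiM.
Qed.

Lemma sub_splitting_prime p : splitting_prime G p `<=` maxideal G.
Proof. by move=> x /(_ 0%N id); apply; split=> // r y; rewrite expn0 expr1. Qed.

End Grading.

(** * Compatible ideals and descent of splittings *)

Section CompatibleIdeals.
Variable A : comNzRingType.
Implicit Types (G : nat -> set A) (J : set A).

(** The composite [psi \o phi] is itself one of the maps, of level [e + e'], that test membership of
    [x]. *)
Lemma compatible_splitting_prime G p : compatible p (splitting_prime G p).
Proof.
move=> e phi [phiD phiM] x Px e' psi [psiD psiM].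
apply: (Px (e + e')%N (psi \o phi)); split=> [y z|r y] /=.
  by rewrite phiD psiD.
by rewrite expnD mulnC exprM phiM psiM.
Qed.

(** The same [f] and [psi] serve for the quotient: compatibility makes [psi] preserve [J]. *)
Lemma fpt_quot_compatible (Rr : realType) G p J : is_ideal J -> compatible p J ->
  (fpt_quot Rr G p [set 0%R] <= fpt_quot Rr G p J)%E.
Proof.
move=> idJ compJ; apply: ereal_sup_le => _ [l [l_ge0 [e0 lP]] <-].
exists l => //; split=> //; exists e0 => e /lP[f [fpow [psi]]].
move=> [[psi0 [psiD psiM]] /subr0_eq psif]; exists f; split=> //.
(* Congruences modulo the zero ideal are equalities. *)
have psi_lin : plinear p e psi.
  split=> [x y|r x]; apply: subr0_eq.
    exact: psiD.
  exact: psiM.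
exists psi; split; last by rewrite psif subrr; exact: idJ.1.
split=> [x|]; first exact: (compJ e psi psi_lin).
split=> [x y|r x]; first by rewrite psi_lin.1 subrr; exact: idJ.1.
by rewrite psi_lin.2 subrr; exact: idJ.1.
Qed.

Lemma test_ideal_ideal p : is_ideal (@test_ideal A p).
Proof.
split; first by move=> M m _; rewrite scale0r.
split=> [x y Tx Ty M m mP|r x Tx M m mP].
  by rewrite scalerDl Tx // Ty // addr0.
by rewrite -scalerA Tx // scaler0.
Qed.

End CompatibleIdeals.

(** * The module of additive maps from [A] to [M] *)

Section AdditiveMaps.
Variables (A : comNzRingType) (M : lmodType A).

Record addmap := AddMap {
  addmap_fun :> A -> M;
  addmapD : forall x y, addmap_fun (x + y) = addmap_fun x + addmap_fun y }.

Lemma addmap_eq (g h : addmap) : g =1 h -> g = h.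
Proof.
case: g h => [g gD] [h hD] /= /funext gh; rewrite gh in gD *.
by congr AddMap; exact: Prop_irrelevance.
Qed.

HB.instance Definition _ := gen_eqMixin addmap.
HB.instance Definition _ := gen_choiceMixin addmap.

Fact addmap_zero_subproof (x y : A) : 0 = 0 + 0 :> M.
Proof. by rewrite addr0. Qed.
Fact addmap_opp_subproof (g : addmap) x y : - g (x + y) = - g x - g y.
Proof. by rewrite addmapD opprD. Qed.
Fact addmap_add_subproof (g h : addmap) x y :
  g (x + y) + h (x + y) = g x + h x + (g y + h y).
Proof. by rewrite !addmapD addrACA. Qed.
Fact addmap_scale_subproof a (g : addmap) x y :
  g ((x + y) * a) = g (x * a) + g (y * a).
Proof. by rewrite mulrDl addmapD. Qed.

Definition addmap_zero := AddMap addmap_zero_subproof.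
Definition addmap_opp g := AddMap (addmap_opp_subproof g).
Definition addmap_add g h := AddMap (addmap_add_subproof g h).
(** The action is on the argument, not on the value; under it the map [y |-> phi y *: n] depends
    p^e-semilinearly on [n]. *)
Definition addmap_scale a g := AddMap (addmap_scale_subproof a g).

Fact addmap_addA : associative addmap_add.
Proof. by move=> f g h; apply: addmap_eq => x /=; rewrite addrA. Qed.
Fact addmap_addC : commutative addmap_add.
Proof. by move=> f g; apply: addmap_eq => x /=; rewrite addrC. Qed.
Fact addmap_add0 : left_id addmap_zero addmap_add.
Proof. by move=> f; apply: addmap_eq => x /=; rewrite add0r. Qed.
Fact addmap_addN : left_inverse addmap_zero addmap_opp addmap_add.
Proof. by move=> f; apply: addmap_eq => x /=; rewrite addNr. Qed.

HB.instance Definition _ :=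
  GRing.isZmodule.Build addmap addmap_addA addmap_addC addmap_add0 addmap_addN.

Fact addmap_scaleA a b g :
  addmap_scale a (addmap_scale b g) = addmap_scale (a * b) g.
Proof. by apply: addmap_eq => x /=; rewrite mulrA. Qed.
Fact addmap_scale1 : left_id 1 addmap_scale.
Proof. by move=> g; apply: addmap_eq => x /=; rewrite mulr1. Qed.
Fact addmap_scaleDr : right_distributive addmap_scale +%R.
Proof. by move=> a g h; apply: addmap_eq. Qed.
Fact addmap_scaleDl g : {morph addmap_scale^~ g : a b / a + b}.
Proof. by move=> a b; apply: addmap_eq => x /=; rewrite mulrDr addmapD. Qed.

HB.instance Definition _ := GRing.Zmodule_isLmodule.Build A addmap
  addmap_scaleA addmap_scale1 addmap_scaleDr addmap_scaleDl.

End AdditiveMaps.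

(* The map [iota] below is the adjoint of [s (x) m |-> phi s *: m] on F^e(M).
   Being p^e-semilinear, it preserves the tight closure of zero, and a scalar
   [x] killing [iota m] satisfies [phi x *: m = 0]. *)
Lemma compatible_test_ideal (A : comNzRingType) (p : nat) :
  compatible p (@test_ideal A p).
Proof.
move=> e phi [phiD phiM] x Tx M m [c [cP [e0 e0P]]].
have iotaP n y z : phi (y + z) *: n = phi y *: n + phi z *: n :> M.
  by rewrite phiD scalerDl.
pose iota n : addmap M := AddMap (iotaP n).
suff : tight_closure0 p (iota m).
  (* Evaluation at 1 turns [x *: iota m = 0] into [phi x *: m = 0]. *)
  by move=> /Tx /(congr1 (fun g : addmap M => g 1)) /=; rewrite mul1r.
exists c; split=> //; exists e0 => e' le_e N B BDl BDr Bbal.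
(* A balanced map of level [e'] pulls back along [iota] to one of level [e + e'] on [M], which kills
   the pair of [c] and [m]. *)
apply: (e0P (e + e')%N (leq_trans le_e (leq_addl _ _)) N (fun s n => B s (iota n))).
- by move=> *; exact: BDl.
- move=> s n n'; rewrite -BDr; congr (B s _).
  by apply: addmap_eq => y /=; rewrite scalerDr.
- move=> s r n; rewrite expnD exprM Bbal; congr (B s _).
  by apply: addmap_eq => y /=; rewrite mulrC phiM scalerA mulrC.
Qed.

(** * Threshold inequalities for [J], the test ideal and the splitting prime *)

Local Open Scope ereal_scope.

Theorem theorem4p7 (Rr : realType) (A : comNzRingType) (G : nat -> set A)
  (p : nat) (J : set A) :
  prime p -> p \in [pchar A] ->
  std_graded G -> noetherian A -> Ffinite G p -> @Fpure A p ->
  homogeneous G J -> compatible p J ->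
  fpt_quot Rr G p [set (0 : A)%R] <= fpt_quot Rr G p J /\
  fpt_quot Rr G p [set (0 : A)%R] <= fpt_quot Rr G p (@test_ideal A p) /\
  fpt_quot Rr G p [set (0 : A)%R] <= fpt_quot Rr G p (splitting_prime G p) /\
  fpt_quot Rr G p (splitting_prime G p) <= sdim Rr G p.
Proof.
move=> p_pr chAp sgG noethA _ _ hJ compJ.
have hP := homogeneous_splitting_prime sgG chAp.
split; first by apply: fpt_quot_compatible => //; exact: hJ.1.
split; first by apply: fpt_quot_compatible;
  [exact: test_ideal_ideal | exact: compatible_test_ideal].
split; first by apply: fpt_quot_compatible;
  [exact: hP.1 | exact: compatible_splitting_prime].
by apply: fpt_quot_le_dim => //; exact: sub_splitting_prime.
Qed.
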